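(* Let $(a_m)_{m\ge 0}$ be an arbitrary sequence of complex numbers with $a_0=0$, let $t$ be a complex number with $t\neq 0$ and $t\neq 1$, and let $n$ be a positive integer. Then $$\sum_{\pi\in P(n)} t^{k(\pi)-1}\left(\frac{t-1}{t}\right)^{Q(\pi)-1}\sum_{j=1}^{s(\pi)}\left(a_{l(\pi)-s(\pi)+j}-t\,a_{l(\pi)-s(\pi)+j-1}\right)=\sum_{d\mid n} a_d,$$ where the sum on the right is over all positive divisors $d$ of $n$.
   Context: A partition of a positive integer $n$ is a sequence $\pi=(k_1,k_2,\dots)$ of non-negative integers, only finitely many nonzero, with $n=\sum_{j\ge1} j k_j$; the integer $k_j$ is the multiplicity of the part $j$, and the parts of $\pi$ are the $j$ with $k_j>0$. $P(n)$ denotes the set of all partitions of $n$. For $\pi\in P(n)$: $k(\pi)=\sum_j k_j$ is the total number of parts (counted with multiplicity), $Q(\pi)=\#\{j: k_j>0\}$ is the number of distinct parts, $s(\pi)$ is the smallest part, and $l(\pi)$ is the largest part. *)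

(* Defs.v *)
From mathcomp Require Import all_boot.

Set Implicit Arguments.
Unset Strict Implicit.
Unset Printing Implicit Defensive.

(* A partition of n has no part larger than n and no multiplicity larger than
   n, so it is encoded by the finite family of its multiplicities k_1, ..., k_n:
   the index j : 'I_n (that is, 0 <= j < n) stands for the part j.+1, and pi j
   is the multiplicity k_(j+1).  See P_complete below. *)
Definition multiplicities (n : nat) := {ffun 'I_n -> 'I_n.+1}.

Definition P (n : nat) : {set multiplicities n} :=
  [set pi : multiplicities n | \sum_(j < n) j.+1 * pi j == n].

Definition nparts (n : nat) (pi : multiplicities n) : nat := \sum_(j < n) pi j.

Definition ndistinct (n : nat) (pi : multiplicities n) : nat :=
  #|[set j : 'I_n | 0 < pi j]|.

(* No part exceeds n, so the default n of the iterated minimum is harmless: it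
   is returned only when it is the smallest part or when there is no part. *)
Definition smallest (n : nat) (pi : multiplicities n) : nat :=
  \big[minn/n]_(j < n | 0 < pi j) j.+1.

Definition largest (n : nat) (pi : multiplicities n) : nat :=
  \max_(j < n | 0 < pi j) j.+1.

(* Every finitely supported sequence (k_1, k_2, ...) with \sum_j j k_j = n
   vanishes beyond n and is represented by exactly one element of P n; the
   value k 0 plays no role. *)
Lemma P_complete (n N : nat) (k : nat -> nat) :
    (forall j, N < j -> k j = 0) -> \sum_(1 <= j < N.+1) j * k j = n ->
  (forall j, n < j -> k j = 0) /\
  (exists! pi : multiplicities n, pi \in P n /\ forall j : 'I_n, pi j = k j.+1 :> nat).
Proof.
move=> kN sumk.
have le_jk j : 0 < j -> j * k j <= n.
  move=> j0; case: (leqP j N) => [jN|/kN ->]; last by rewrite muln0.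
  rewrite -sumk (bigD1_seq j) ?iota_uniq ?mem_index_iota ?j0 ?ltnS //=.
  exact: leq_addr.
have k0 j : n < j -> k j = 0.
  move=> nj; have j0 : 0 < j by apply: leq_ltn_trans nj.
  case: (posnP (k j)) => // kj; have := leq_trans (leq_pmulr j kj) (le_jk j j0).
  by rewrite leqNgt nj.
have kn j : 0 < j -> k j < n.+1.
  by move=> j0; rewrite ltnS (leq_trans _ (le_jk j j0)) // leq_pmull.
have ext M m : M <= m -> (forall j, M < j -> k j = 0) ->
    \sum_(1 <= j < m.+1) j * k j = \sum_(1 <= j < M.+1) j * k j.
  move=> Mm kM; rewrite (@big_cat_nat _ _ _ M.+1) //= [X in _ + X]big_nat.
  rewrite [X in _ + X]big1 ?addn0 // => j /andP[Mj _].
  by rewrite kM ?muln0.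
split=> //; exists [ffun j : 'I_n => Ordinal (kn j.+1 isT)]; split; last first.
  move=> pi [_ Hpi]; apply/ffunP => j; apply/val_inj.
  by rewrite ffunE /= Hpi.
split; last by move=> j; rewrite ffunE.
rewrite inE; apply/eqP.
under eq_bigr => j _ do rewrite ffunE /=.
rewrite -[RHS]sumk -(ext N (maxn n N)) ?leq_maxr // (ext n (maxn n N)) ?leq_maxl //.
by rewrite big_add1 /= big_mkord.
Qed.

(* Main.v *)
Require Import Defs.
From HB Require Import structures.
From mathcomp Require Import all_boot all_order all_algebra.
From mathcomp Require Import qpoly ring zify.
From mathcomp Require Import reals complex.

(* Let s, l be the smallest and largest part of pi, and let w(pi) be its weight
   t^(k-1) ((t-1)/t)^(Q-1).  The coefficient of a_m in the left-hand side is
   f_m - t f_(m+1), where f_m sums w(pi) over the partitions pi of n with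
   l - s < m <= l, that is, whose parts all lie in the window (l - m, l].  With
   e_i = 1/(1 - t q^i) and c_i = (1 - q^i) e_i = 1 + sum_(k > 0) (t-1) t^(k-1) q^(ik),
   the generating function of the f_m is
     F_m = sum_(l >= m) q^l e_l prod_(l-m < i < l) c_i,
   and (1 - q^m) (F_m - t F_(m+1)) telescopes to q^m, so that
   f_m - t f_(m+1) = [m | n].  All of this takes place in K[q]/(q^(n+1)). *)

Set Implicit Arguments.
Unset Strict Implicit.
Unset Printing Implicit Defensive.

Import GRing.Theory.
Local Open Scope ring_scope.

(** * Telescoping in a commutative ring with nilpotent q *)

Lemma geometric_inverse (S : comNzRingType) (x : S) N :
  x ^+ N = 0 -> (1 - x) * \sum_(k < N) x ^+ k = 1.
Proof. by move=> xN; rewrite -opprB mulNr -subrX1 xN sub0r opprK. Qed.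

(** The index is r = l - m instead of l: for equal r the windows for [m] and [m.+1] start at the
    same part, so the difference can be taken term by term. *)
Lemma window_telescope (S : comNzRingType) (t q : S) (e : nat -> S) (N m : nat) :
  q ^+ N = 0 -> (forall i, (0 < i)%N -> (1 - t * q ^+ i) * e i = 1) ->
  (0 < m)%N ->
  let F m := \sum_(r < N) q ^+ (r + m) * e (r + m)%N *
               \prod_(r.+1 <= i < r + m) ((1 - q ^+ i) * e i) in
  (1 - q ^+ m) * (F m - t * F m.+1) = q ^+ m.
Proof.
move=> qN eK; case: m => // m _ F.
(* The r-th term of the left-hand side is q^m (U (r+1) - U r); here U 0 = 0
   because of the factor 1 - q^0, and U N = 1 because q^i = 0 for i >= N. *)
pose U r := (\prod_(r <= i < r + m.+1) (1 - q ^+ i)) *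
            \prod_(r.+1 <= i < (r + m.+1).+1) e i.
have q0 i : (N <= i)%N -> q ^+ i = 0.
  by move=> Ni; rewrite -(subnKC Ni) exprD qN mul0r.
have UN : U N = 1.
  rewrite /U big_nat big1 => [|i /andP[Ni _]]; last by rewrite q0 ?subr0.
  rewrite mul1r big_nat big1 // => i /andP[Ni _].
  by have := eK i (leq_ltn_trans (leq0n _) Ni); rewrite q0 1?ltnW // mulr0 subr0 mul1r.
have U0 : U 0%N = 0.
  by rewrite /U add0n big_nat_recl //= expr0 subrr !mul0r.
have step r : (1 - q ^+ m.+1) * (q ^+ (r + m.+1) * e (r + m.+1)%N *
               \prod_(r.+1 <= i < r + m.+1) ((1 - q ^+ i) * e i)
             - t * (q ^+ (r + m.+2) * e (r + m.+2)%N *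
               \prod_(r.+1 <= i < r + m.+2) ((1 - q ^+ i) * e i)))
           = q ^+ m.+1 * (U r.+1 - U r).
  rewrite /U addSn !addnS !big_split /=.
  have le1 : (r < (r + m).+1)%N by lia.
  have le2 : (r < (r + m).+2)%N by lia.
  rewrite !(@big_nat_recr _ _ _ (r + m).+1 r.+1) //=.
  rewrite (@big_ltn _ _ _ r (r + m).+1) //.
  set P1 := \prod_(r.+1 <= i < _) (1 - _).
  set P2 := \prod_(r.+1 <= i < (r + m).+1) e i.
  set E2 := \prod_(r.+2 <= i < (r + m).+3) e i.
  (* [E2] starts one index later than [P2]; the missing factor [e r.+1] is restored at the cost of
     its inverse. *)
  have E2E : E2 = (1 - t * q ^+ r.+1) * (P2 * e (r + m).+1 * e (r + m).+2).
    rewrite -!big_nat_recr //= big_ltn; last by lia.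
    by rewrite mulrA eK // mul1r.
  rewrite {}E2E {E2}; have := eK (r + m).+2 isT.
  rewrite !(exprS, exprD).
  set f := e (r + m).+1; set f' := e (r + m).+2; set x := q ^+ r; set y := q ^+ m.
  move: P1 P2 f f' x y => P1 P2 f f' x y fK.
  (* The two terms without [f'] are multiplied by (1 - t q^(r+m+2)) [f'] = 1; what remains is a
     polynomial identity. *)
  rewrite (_ : q * (x * y) * f * (P1 * P2) =
    (1 - t * (q * (q * (x * y))) ) * f' * (q * (x * y) * f * (P1 * P2))); last by rewrite fK mul1r.
  rewrite (_ : (1 - x) * P1 * (P2 * f) =
    (1 - t * (q * (q * (x * y))) ) * f' * ((1 - x) * P1 * (P2 * f))); last by rewrite fK mul1r.
  by ring.
rewrite /F mulr_sumr -sumrB mulr_sumr.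
rewrite (eq_bigr (fun r : 'I_N => q ^+ m.+1 * (U r.+1 - U r))) => [|r _]; last exact: step.
rewrite -mulr_sumr -(big_mkord xpredT (fun r => U r.+1 - U r)) telescope_sumr //.
by rewrite UN U0 subr0 mulr1.
Qed.

(** [phi] reads off the coefficient of q^n. Later arguments use only these two properties, so the
    quotient ring stays abstract. *)
Lemma truncated_polynomials (K : fieldType) (n : nat) :
  exists (S : comUnitAlgType K) (q : S) (phi : {scalar S}),
    q ^+ n.+1 = 0 /\ forall i, phi (q ^+ i) = (i == n)%:R.
Proof.
pose h : {poly K} := 'X^(n.+1).
have hE : mk_monic h = h by rewrite /h mk_monic_Xn.
pose coefn (s : {poly %/ h}) : K := (s : {poly K})`_n.
have coefn_linear : scalar coefn.
  by move=> c u v; rewrite /coefn poly_of_qpolyD poly_of_qpolyZ coefD coefZ.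
pose phi : {scalar {poly %/ h}} :=
  HB.pack coefn (GRing.isLinear.Build K {poly %/ h} K _ coefn coefn_linear).
have q0 : in_qpoly h 'X ^+ n.+1 = 0.
  rewrite -rmorphXn; apply/val_eqP; rewrite /= hE.
  by rewrite Pdiv.RingMonic.rmodpp // monicXn.
exists ({poly %/ h} : comUnitAlgType K), (in_qpoly h 'X), phi.
split=> // i; case: (ltnP i n.+1) => [lt_in|lt_ni].
  rewrite -rmorphXn /phi /= /coefn in_qpoly_small ?coefXn 1?eq_sym //.
  by rewrite hE !size_polyXn.
by rewrite gtn_eqF // -(subnKC lt_ni) exprD q0 mul0r linear0.
Qed.

(** * Partitions with all parts in a window *)

Lemma leq_smallest (n k : nat) (pi : multiplicities n) : (k <= n)%N ->
  (k <= smallest pi)%N = [forall i : 'I_n, (0 < pi i)%N ==> (k <= i.+1)%N].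
Proof.
move=> kn; rewrite /smallest (big_morph (leq k) (leq_min k) kn) big_andE.
by [].
Qed.

Lemma largest_leq (n k : nat) (pi : multiplicities n) :
  (largest pi <= k)%N = [forall i : 'I_n, (0 < pi i)%N ==> (i < k)%N].
Proof.
by apply/bigmax_leqP/forallP => [h i|h i ?]; [apply/implyP/h | apply/(implyP (h i))].
Qed.

(** The condition on the extreme parts becomes a separate condition on each multiplicity, which a
    product over the parts can detect. *)
Lemma window_partitionE (n m : nat) (pi : multiplicities n) (j : 'I_n) :
  (0 < m <= j.+1)%N ->
  (largest pi == j.+1) && (largest pi - smallest pi < m)%N =
  (0 < pi j)%N && [forall i : 'I_n, (0 < pi i)%N ==> (i <= j < i + m)%N].
Proof.
case/andP=> m0 mj; have jn := ltn_ord j.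
have sE : (j.+1 - smallest pi < m)%N = (j.+2 - m <= smallest pi)%N by lia.
have kn : (j.+2 - m <= n)%N by lia.
apply/andP/andP => [[/eqP lE]|[pij /forallP H]].
  rewrite lE sE leq_smallest // => /forallP H; split; last first.
    apply/forallP => i; apply/implyP => pii; have := implyP (H i) pii.
    have := leqnn (largest pi); rewrite {2}lE largest_leq => /forallP/(_ i)/implyP/(_ pii).
    lia.
  rewrite lt0n; apply/negP => /eqP pij0.
  have : (largest pi <= j)%N.
    rewrite largest_leq; apply/forallP => i; apply/implyP => pii.
    have := leqnn (largest pi); rewrite {2}lE largest_leq => /forallP/(_ i)/implyP/(_ pii).
    rewrite ltnS leq_eqVlt => /orP[/eqP/val_inj ij|//].
    by move: pii; rewrite ij pij0.
  by rewrite lE ltnn.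
have lE : largest pi = j.+1.
  apply/eqP; rewrite eqn_leq; apply/andP; split.
    rewrite largest_leq; apply/forallP => i; apply/implyP => /(implyP (H i)).
    by case/andP.
  by rewrite ltnNge largest_leq; apply/negP => /forallP/(_ j)/implyP/(_ pij); rewrite ltnn.
rewrite lE sE leq_smallest //; split=> //.
by apply/forallP => i; apply/implyP => /(implyP (H i)); lia.
Qed.

(** * The weight as a product over the parts *)

Section Weights.
Variables (K : fieldType) (t : K).

Definition weight (n : nat) (pi : multiplicities n) : K :=
  t ^+ (nparts pi - 1) * ((t - 1) / t) ^+ (ndistinct pi - 1).

(* Contribution of the multiplicity k of the part i+1 to the weight of a
   partition with largest part j+1 and all parts in the window (j+1-m, j+1]. *)
Definition window_weight (n m : nat) (j i : 'I_n) (k : nat) : K :=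
  if k is k'.+1 then
    if i == j then t ^+ k' else if (i < j < i + m)%N then (t - 1) * t ^+ k' else 0
  else (i != j)%:R.

(** The largest part, with factor t^(k-1), absorbs the -1 of both exponents; any other part present
    gives t^k (t-1)/t = (t-1) t^(k-1). A part outside the window, or the absence of the part j+1,
    gives a factor 0. *)
Lemma prod_window_weight (n m : nat) (j : 'I_n) (pi : multiplicities n) :
  t != 0 -> (0 < m <= j.+1)%N ->
  \prod_i window_weight m j i (pi i) =
  if (largest pi == j.+1) && (largest pi - smallest pi < m)%N
  then weight pi else 0.
Proof.
move=> t0 mj; rewrite window_partitionE //.
case: ifP => [/andP[pij /forallP H]|/negbT].
  have sE : nparts pi = (pi j + \sum_(i | i != j) pi i)%N.
    by rewrite /nparts (bigD1 j).
  have dE : ndistinct pi = (\sum_(i | i != j) (0 < pi i)).+1.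
    rewrite /ndistinct -sum1dep_card big_mkcond (bigD1 j) //= pij add1n.
    by congr _.+1; apply: eq_bigr => i _; case: (0 < pi i)%N.
  rewrite /weight sE dE subn1 [in RHS]subn1 /= -subn1 -addnBAC // exprD.
  rewrite -mulrA -!prodrXr -big_split (bigD1 j) //=; congr (_ * _).
    by rewrite /window_weight; case: (pi j : nat) pij => // k _; rewrite eqxx subn1.
  apply: eq_bigr => i ij; rewrite /window_weight.
  have := implyP (H i); case: (pi i : nat) => [|k] /=; first by rewrite ij mulr1.
  rewrite (negbTE ij) => /(_ isT) ijm.
  have -> : (i < j < i + m)%N.
    by move: ij ijm; rewrite -val_eqE /=; lia.
  by rewrite exprS expr1; field.
rewrite negb_and -leqNgt leqn0 => /orP[/eqP pij|].
  by rewrite (bigD1 j) //= pij /window_weight eqxx mul0r.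
rewrite negb_forall => /existsP [] i; rewrite negb_imply => /andP[pii ijm].
rewrite (bigD1 i) //= /window_weight; case: (pi i : nat) pii => // k _.
have -> : (i == j) = false by apply/negP => /eqP ij; move: ijm mj; rewrite ij; lia.
by rewrite ifN ?mul0r //; lia.
Qed.

End Weights.

(** * Generating functions modulo q^(n+1) *)

Section WindowSeries.
Variables (K : fieldType) (t : K) (n : nat) (S : comUnitAlgType K) (q : S).
Hypothesis (t0 : t != 0) (qn : q ^+ n.+1 = 0).

Definition geometric (i : nat) : S := \sum_(k < n.+1) (t%:A * q ^+ i) ^+ k.

Lemma q_large i : (n < i)%N -> q ^+ i = 0.
Proof. by move=> ni; rewrite -(subnKC ni) exprD qn mul0r. Qed.

Lemma geometricK i : (0 < i)%N -> (1 - t%:A * q ^+ i) * geometric i = 1.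
Proof.
move=> i0; apply: geometric_inverse.
by rewrite exprMn -exprM q_large ?mulr0 // leq_pmull.
Qed.

Lemma q_geometric i : (0 < i)%N ->
  q ^+ i * geometric i = \sum_(k < n) t ^+ k *: q ^+ (i * k.+1).
Proof.
move=> i0; rewrite /geometric big_ord_recr /= mulrDr.
(* The last term carries q^(i(n+1)), whose exponent exceeds n. *)
rewrite [X in _ + X](_ : _ = 0) ?addr0; last first.
  by rewrite exprMn mulrCA -exprM -exprD -mulnS q_large ?mulr0 // leq_pmull.
rewrite mulr_sumr; apply: eq_bigr => k _.
by rewrite exprMn mulrCA -exprM -exprD -mulnS exprZn expr1n mulr_algl.
Qed.

Lemma window_weight_series (m : nat) (j i : 'I_n) :
  \sum_(k < n.+1) window_weight t m j i k *: q ^+ (i.+1 * k) =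
  if i == j then q ^+ i.+1 * geometric i.+1
  else if (i < j < i + m)%N then (1 - q ^+ i.+1) * geometric i.+1 else 1.
Proof.
rewrite big_ord_recl /= muln0 expr0.
case: eqP => [_|_] /=; first by rewrite scale0r add0r q_geometric.
rewrite scale1r; case: ifP => _; last first.
  by rewrite big1 ?addr0 // => k _; rewrite scale0r.
(* Splitting 1 - q^i = (1 - t q^i) + (t - 1) q^i gives c_i = 1 + (t - 1) q^i e_i. *)
have -> : (1 - q ^+ i.+1) * geometric i.+1 =
    (1 - t%:A * q ^+ i.+1) * geometric i.+1 +
    (t - 1)%:A * (q ^+ i.+1 * geometric i.+1).
  by rewrite scalerBl scale1r; ring.
rewrite geometricK // q_geometric // mulr_algl scaler_sumr.
by congr (_ + _); apply: eq_bigr => k _; rewrite scalerA.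
Qed.

Definition window_sum (m : nat) : S :=
  \sum_(r < n.+1) q ^+ (r + m) * geometric (r + m) *
    \prod_(r.+1 <= i < r + m) ((1 - q ^+ i) * geometric i).

(** Substituting l = r + m makes the largest part l = j+1 the summation index; terms with l > n
    vanish with q^l. *)
Lemma window_sum_ord (m : nat) : (0 < m <= n.+1)%N ->
  window_sum m =
  \sum_(j < n | (m <= j.+1)%N) q ^+ j.+1 * geometric j.+1 *
    \prod_(i < n | (i < j < i + m)%N) ((1 - q ^+ i.+1) * geometric i.+1).
Proof.
case/andP=> m0 mn; pose f l : S := q ^+ l * geometric l *
    \prod_((l - m).+1 <= i < l) ((1 - q ^+ i) * geometric i).
transitivity (\sum_(0 <= r < n.+1) f (r + m)%N).
  by rewrite big_mkord; apply: eq_bigr => r _; rewrite /f addnK.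
transitivity (\sum_(0 + m <= l < n.+1 + m) f l); first by rewrite big_addn addnK.
rewrite add0n (@big_cat_nat _ _ _ n.+1) ?leq_addr //=.
rewrite [X in _ + X]big_nat [X in _ + X]big1 ?addr0; last first.
  by move=> l /andP[nl _]; rewrite /f q_large // !mul0r.
rewrite (big_nat_widenl _ 0) // big_mkcond big_nat_recl //= leqn0 gtn_eqF // add0r.
rewrite -big_mkcond big_mkord; apply: eq_bigr => j mj; rewrite /f; congr (_ * _).
rewrite big_add1 /= (big_nat_widenl _ 0) // (big_nat_widen _ _ n) ?(ltnW (ltn_ord j)) //.
by rewrite big_mkord; apply: eq_bigl => i; lia.
Qed.

Definition in_window (m : nat) (pi : multiplicities n) : bool :=
  (largest pi - smallest pi < m <= largest pi)%N.

Lemma window_sum_partitions (m : nat) : (0 < m <= n.+1)%N ->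
  window_sum m = \sum_(pi : multiplicities n)
    ((in_window m pi)%:R * weight t pi) *: q ^+ (\sum_(j < n) j.+1 * pi j)%N.
Proof.
move=> m0n; rewrite window_sum_ord //; case/andP: m0n => m0 mn.
transitivity (\sum_(j < n | (m <= j.+1)%N) \sum_(pi : multiplicities n)
    (\prod_i window_weight t m j i (pi i)) *: q ^+ (\sum_(i < n) i.+1 * pi i)%N).
  apply: eq_bigr => j mj.
  under [RHS]eq_bigr => pi _ do rewrite -prodrXr -scaler_prod.
  (* Distributivity: a sum over all multiplicity families is a product over the parts of sums over
     one multiplicity. *)
  rewrite -(bigA_distr_bigA (fun (i : 'I_n) (k : 'I_n.+1) =>
    window_weight t m j i k *: q ^+ (i.+1 * k))).
  under [RHS]eq_bigr => i _ do rewrite window_weight_series.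
  rewrite [RHS](bigD1 j) //= eqxx; congr (_ * _); rewrite big_mkcond [RHS]big_mkcond.
  apply: eq_bigr => i _; case: eqP => //= ->; by rewrite ltnn.
rewrite exchange_big; apply: eq_bigr => pi _ /=.
rewrite -scaler_suml; congr (_ *: _).
under eq_bigr => j mj do rewrite prod_window_weight ?m0 //.
have ln : (largest pi <= n)%N by rewrite largest_leq; apply/forallP => i; apply/implyP.
rewrite /in_window; case: (leqP m (largest pi)) => [ml|lm]; last first.
  rewrite andbF mul0r big1 // => j mj.
  by rewrite ifN //; apply/nandP; left; apply/eqP => lE; move: lm; rewrite lE ltnNge mj.
have l0 := leq_trans m0 ml; have jn : ((largest pi).-1 < n)%N by rewrite prednK.
(* For a fixed [pi], only the index j with j+1 = [largest pi] can contribute. *)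
rewrite (bigD1 (Ordinal jn)) /= prednK // eqxx /= big1 ?addr0 => [|j /andP[_ jj]].
  by rewrite andbT; case: ifP; rewrite ?mul1r ?mul0r.
rewrite ifN //; apply/nandP; left; apply: contra jj => /eqP lE.
by apply/eqP/val_inj; rewrite /= lE.
Qed.

(** The telescoped identity is divided by 1 - q^m, whose inverse is a finite geometric sum. *)
Lemma window_sum_recurrence (m : nat) : (0 < m)%N ->
  window_sum m - t *: window_sum m.+1 = \sum_(k < n.+1) q ^+ (m * k.+1).
Proof.
move=> m0; have := window_telescope qn geometricK m0.
rewrite /= -/(window_sum m) -/(window_sum m.+1) mulr_algl.
move=> /(congr1 ( *%R (\sum_(k < n.+1) (q ^+ m) ^+ k))).
rewrite mulrA [_ * (1 - _)]mulrC geometric_inverse; last by rewrite -exprM q_large // leq_pmull.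
rewrite mul1r => ->; rewrite mulr_suml; apply: eq_bigr => k _.
by rewrite -exprM -exprD mulnS addnC.
Qed.

End WindowSeries.

(** * Extraction of the coefficient of q^n *)

Section Coefficients.
Variables (K : fieldType) (t : K) (n : nat).
Hypothesis t0 : t != 0.

Definition window_coef (m : nat) : K :=
  \sum_(pi in P n) (in_window m pi)%:R * weight t pi.

(** Apply [phi] to the recurrence of the series. The case m = n involves [window_coef n.+1], hence
    the bound n+1 in [window_sum_partitions]. *)
Lemma window_coef_recurrence (m : nat) : (0 < m <= n)%N ->
  window_coef m - t * window_coef m.+1 = (m %| n)%:R.
Proof.
case/andP=> m0 mn.
have [S [q [phi [qn phiE]]]] := truncated_polynomials K n.
have coefE k : (0 < k <= n.+1)%N -> phi (window_sum t n q k) = window_coef k.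
  move=> kn; rewrite window_sum_partitions // linear_sum /window_coef [RHS]big_mkcond.
  apply: eq_bigr => pi _; rewrite linearZ /= phiE inE.
  by case: eqP; rewrite ?mulr1 ?mulr0.
transitivity (phi (window_sum t n q m - t *: window_sum t n q m.+1)).
  by rewrite linearB linearZ /= !coefE ?m0 //= leqW.
rewrite window_sum_recurrence // linear_sum.
under eq_bigr => k _ do rewrite phiE.
case: (boolP (m %| n)%N) => [/dvdnP[d dE]|ndvd]; last first.
  rewrite big1 // => k _; case: eqP => // kE.
  by move: ndvd; rewrite -kE dvdn_mulr.
have d0 : (0 < d)%N by case: d dE => //; move: m0 mn; case: n => //; lia.
have dn : (d.-1 < n.+1)%N by rewrite dE; nia.
(* With n = d m, the exponent m(k+1) equals n exactly for k = d-1. *)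
rewrite (bigD1 (Ordinal dn)) //= prednK // mulnC -dE eqxx big1 ?addr0 // => k kd.
case: eqP => // kE; case/eqP: kd; apply/val_inj => /=.
have : (m * k.+1 = d * m)%N by rewrite kE.
nia.
Qed.

End Coefficients.

(** * Rearrangement of the left-hand side by the terms of the sequence *)

Lemma smallest_leq_largest (n : nat) (pi : multiplicities n) :
  pi \in P n -> (0 < n)%N -> (smallest pi <= largest pi)%N.
Proof.
rewrite inE => /eqP sumpi n0.
have [i pii] : exists i, (0 < pi i)%N.
  apply/existsP; apply: contraLR n0; rewrite negb_exists => /forallP pi0.
  rewrite -eqn0Ngt -sumpi big1 // => i _.
  by have := pi0 i; rewrite lt0n negbK => /eqP ->; rewrite muln0.
have sn : (smallest pi <= n)%N.
  by rewrite /smallest; elim/big_rec: _ => // k x _ xn; rewrite geq_min xn orbT.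
have := leqnn (largest pi); rewrite {1}largest_leq => /forallP/(_ i)/implyP/(_ pii).
have := leqnn (smallest pi); rewrite {1}leq_smallest // => /forallP/(_ i)/implyP/(_ pii).
exact: leq_trans.
Qed.

(** The range 1..n does not depend on the partition, so this sum can be exchanged with the one over
    partitions. The index 0, reached by the second half when l = s, drops out because a_0 = 0. *)
Lemma sum_shifted_interval (K : comNzRingType) (a : nat -> K) (t : K) (s l n : nat) :
  a 0%N = 0 -> (s <= l <= n)%N ->
  \sum_(1 <= j < s.+1) (a (l - s + j)%N - t * a (l - s + j - 1)%N) =
  \sum_(1 <= m < n.+1)
    a m * ((l - s < m <= l)%N%:R - t * (l - s < m.+1 <= l)%N%:R).
Proof.
move=> a0 /andP[sl ln].
have interval b c (bc : (c <= n.+1)%N) : \sum_(b <= m < c) a m =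
    \sum_(1 <= m < n.+1) a m * (b <= m < c)%N%:R.
  rewrite (big_nat_widenl _ 0) // (big_nat_widen _ _ n.+1) // big_mkcond.
  rewrite big_nat_recl //= a0 if_same add0r [RHS]big_add1 /=; apply: eq_bigr => m _.
  by rewrite /= andbC; case: andP; rewrite ?mulr1 ?mulr0 // andbC.
rewrite sumrB -mulr_sumr.
have -> : \sum_(1 <= j < s.+1) a (l - s + j)%N = \sum_((l - s).+1 <= m < l.+1) a m.
  rewrite -[(l - s).+1]add1n big_addn; have -> : (l.+1 - (l - s) = s.+1)%N by lia.
  by apply: eq_bigr => j _; rewrite addnC.
have -> : \sum_(1 <= j < s.+1) a (l - s + j - 1)%N = \sum_(l - s <= m < l) a m.
  rewrite big_add1 /= -[(l - s)%N]add0n big_addn; have -> : (l - (l - s) = s)%N by lia.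
  by apply: eq_bigr => j _; congr a; lia.
rewrite !interval ?ltnS ?(leqW ln) //. rewrite mulr_sumr -sumrB; apply: eq_bigr => m _.
by rewrite mulrBr mulrCA.
Qed.

Lemma sum_divisors (V : nmodType) (a : nat -> V) (n : nat) : (0 < n)%N ->
  \sum_(d <- divisors n) a d = \sum_(1 <= m < n.+1 | (m %| n)%N) a m.
Proof.
move=> n0; rewrite -[RHS]big_filter; apply: perm_big; apply: uniq_perm.
- exact: divisors_uniq.
- by rewrite filter_uniq ?iota_uniq.
move=> d; rewrite mem_filter mem_index_iota -dvdn_divisors // ltnS andbC.
by case: (boolP (d %| n)%N) => dn; rewrite ?andbF // (dvdn_gt0 n0 dn) dvdn_leq.
Qed.

Lemma corollary2_field (K : fieldType) (a : nat -> K) (t : K) (n : nat) :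
  a 0%N = 0 -> t != 0 -> (0 < n)%N ->
  \sum_(pi in P n) weight t pi *
     \sum_(1 <= j < (smallest pi).+1)
        (a (largest pi - smallest pi + j)%N
         - t * a (largest pi - smallest pi + j - 1)%N)
  = \sum_(d <- divisors n) a d.
Proof.
move=> a0 t0 n0; rewrite sum_divisors //.
transitivity (\sum_(pi in P n) \sum_(1 <= m < n.+1) a m *
  ((in_window m pi)%:R * weight t pi - t * ((in_window m.+1 pi)%:R * weight t pi))).
  apply: eq_bigr => pi piP.
  have sl : (smallest pi <= largest pi <= n)%N.
    rewrite smallest_leq_largest //= largest_leq.
    by apply/forallP => i; apply/implyP.
  rewrite (sum_shifted_interval t a0 sl) mulr_sumr; apply: eq_bigr => m _.
  by rewrite /in_window; ring.
(* After the exchange, a_m has coefficient [window_coef m - t * window_coef m.+1]. *)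
rewrite exchange_big /= [RHS]big_mkcond big_nat [RHS]big_nat.
apply: eq_bigr => m mn.
rewrite -mulr_sumr sumrB -mulr_sumr.
by rewrite (window_coef_recurrence t0) //; case: ifP; rewrite ?mulr1 ?mulr0.
Qed.

Local Open Scope complex_scope.

Theorem corollary2 (R : realType) (a : nat -> R[i]) (t : R[i]) (n : nat)
    (ha0 : a 0%N = 0) (ht0 : t <> 0) (ht1 : t <> 1) (hn : (0 < n)%N) :
  \sum_(pi in P n)
     t ^+ (nparts pi - 1) * ((t - 1) / t) ^+ (ndistinct pi - 1) *
     \sum_(1 <= j < (smallest pi).+1)
        (a (largest pi - smallest pi + j)%N
         - t * a (largest pi - smallest pi + j - 1)%N)
  = \sum_(d <- divisors n) a d.
Proof. by apply: corollary2_field => //; apply/eqP. Qed.
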